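(* The optimal budget allocation $x^*$ of the problem $\mathscr{B} = \min_{x\in\mathscr{X}} \mathbb{B}(x)$, and also of the problem $\mathscr{P} = \min_{x\in\mathscr{X}} \mathbb{P}(x)$ (that is, the minimizer over $\mathscr{X}$ of $\mathbb{B}$, and also the minimizer over $\mathscr{X}$ of $\mathbb{P}$), is given by $$x_j^* = \frac{\beta_j}{\sum_{m \in L \cup C} \beta_m} \cdot R \quad \text{for all } j \in C,$$ $$x_{ij}^* = \frac{\beta_j}{\sum_{m \in L \cup C} \beta_m} \cdot R \cdot \frac{\exp\left\{\frac{\alpha_i}{1 + \sum_{k \in L} \beta_k}\right\}}{\sum_{m \in N} \exp\left\{\frac{\alpha_m}{1 + \sum_{k \in L} \beta_k}\right\}} \quad \text{for all } i \in N \text{ and all } j \in L.$$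
   Context: Let $N$ (potential pickpocket locations), $L$ (local protective resources) and $C$ (central protective resources) be finite subsets of $\mathbb{N}$ with $N \neq \emptyset$, $N \cap (C \cup L) = \emptyset$, $L \cap C = \emptyset$ and $C \cup L \neq \emptyset$ (one of $C$, $L$ may be empty; empty sums are $0$ and empty products are $1$). Let $R > 0$ be the budget, let $\alpha_i \geq 0$ be real for each $i \in N$, and let $\beta_j > 0$ be real for each $j \in C \cup L$. A budget allocation is a vector $x = ((x_{ij})_{i \in N, j \in L}, (x_j)_{j \in C})$. With $\mathbb{R}_{++} = (0,\infty)$, the set of feasible budget allocations is $$\mathscr{X} = \left\{ x \in \mathbb{R}_{++}^{|N|\cdot|L| + |C|} \;\middle|\; \sum_{i \in N}\sum_{j \in L} x_{ij} + \sum_{j \in C} x_j \leq R\right\}.$$ For $x \in \mathscr{X}$ define $$\mathbb{B}(x) = \sum_{i \in N} \frac{\exp\{\alpha_i\}}{\prod_{j \in C} x_j^{\beta_j} \prod_{j \in L} x_{ij}^{\beta_j}},$$ and the overall pickpocket probability $$\mathbb{P}(x) = \frac{\sum_{i \in N} \exp\left\{\alpha_i - \sum_{j \in L} \beta_j \ln x_{ij} - \sum_{j \in C}\beta_j \ln x_j\right\}}{1 + \sum_{i \in N} \exp\left\{\alpha_i - \sum_{j \in L} \beta_j \ln x_{ij} - \sum_{j \in C}\beta_j \ln x_j\right\}}.$$ *)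

(* Defs.v *)
From mathcomp Require Import all_boot all_order all_algebra finmap.
From mathcomp Require Import all_classical all_reals sequences exp.

Set Implicit Arguments.
Unset Strict Implicit.
Unset Printing Implicit Defensive.

Import Order.TTheory GRing.Theory Num.Theory.

Local Open Scope classical_set_scope.
Local Open Scope ring_scope.

(* Parameters [alpha] and [beta] are total functions on [nat]; only their
   values on [N], respectively on [C `|` L], are ever used. *)

(* The components are [x.1 (i, j) = x_ij] and [x.2 j = x_j]. *)
Definition allocation (R : realType) (N L C : {fset nat}) : Type :=
  ({ffun N * L -> R} * {ffun C -> R})%type.

Definition feasible (R : realType) (N L C : {fset nat}) (budget : R) :
    set (allocation R N L C) :=
  [set x : allocation R N L C |
            [/\ forall (i : N) (j : L), 0 < x.1 (i, j),
               forall j : C, 0 < x.2 j &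
               \sum_(i : N) \sum_(j : L) x.1 (i, j) + \sum_(j : C) x.2 j
                 <= budget]].
Arguments feasible {R} N L C budget.

Definition BB (R : realType) (N L C : {fset nat}) (alpha beta : nat -> R)
    (x : allocation R N L C) : R :=
  \sum_(i : N) expR (alpha (val i)) /
    ((\prod_(j : C) (x.2 j `^ beta (val j))) *
     (\prod_(j : L) (x.1 (i, j) `^ beta (val j)))).

Definition pickpocket_weight (R : realType) (N L C : {fset nat})
    (alpha beta : nat -> R) (x : allocation R N L C) : R :=
  \sum_(i : N) expR (alpha (val i)
                     - \sum_(j : L) beta (val j) * ln (x.1 (i, j))
                     - \sum_(j : C) beta (val j) * ln (x.2 j)).

Definition PP (R : realType) (N L C : {fset nat}) (alpha beta : nat -> R)
    (x : allocation R N L C) : R :=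
  pickpocket_weight alpha beta x / (1 + pickpocket_weight alpha beta x).

Definition argmin (R : realType) (T : Type) (X : set T) (f : T -> R) : set T :=
  [set x | X x /\ forall y, X y -> f x <= f y].

Definition optimal_allocation (R : realType) (N L C : {fset nat})
    (alpha beta : nat -> R) (budget : R) : allocation R N L C :=
  let share j := beta j / (\sum_(m <- (L `|` C)%fset) beta m) * budget in
  let w i := expR (alpha i / (1 + \sum_(k <- L) beta k)) in
  ([ffun ij : N * L =>
      share (val ij.2) * w (val ij.1) / (\sum_(m <- N) w m)],
   [ffun j : C => share (val j)]).

(* Main.v *)
Require Import Defs.
From mathcomp Require Import all_boot all_order all_algebra finmap.
From mathcomp Require Import all_classical all_reals sequences exp.
From mathcomp Require Import ring lra.

Set Implicit Arguments.
Unset Strict Implicit.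
Unset Printing Implicit Defensive.

Import Order.TTheory GRing.Theory Num.Theory.

Local Open Scope classical_set_scope.
Local Open Scope ring_scope.

(** On feasible allocations [BB] is the weight [W x = \sum_i expR (g_i x)],
where [g_i] is the exponent [log_risk], and [PP] is [W / (1 + W)], an
increasing function of [W].  Both problems therefore amount to minimizing [W]
over the feasible set.

Let [z] be the announced optimum, [b] the sum of all [beta j], and [p_i] the
fraction of every local budget that [z] gives to location [i].  The exponent
[1 / (1 + \sum_(k in L) beta k)] in the definition of [p_i] is exactly the one
that makes the risk terms [expR (g_i z)] proportional to the [p_i], so that
[expR (g_i z) = W z * p_i] ([log_risk_opt]).  Bounding each exponential from
below by its tangent at [g_i z] gives
  [W x >= W z * (1 + \sum_i p_i * (g_i x - g_i z))].
Each [g_i x - g_i z] is a combination of the terms [- beta j * ln t], where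
[t] is the ratio of a coordinate of [x] to that of [z].  Writing
[- ln t = ln_gap t + (1 - t)] with [ln_gap t = t - 1 - ln t >= 0], the linear
parts add up to [b * (1 - total x / budget)], because [beta j * t], averaged
with the weights [p_i], is [b / budget] times the coordinate of [x]
([log_risk_avg]).  This is nonnegative by the budget constraint, whence
  [W x >= W z + W z * D x]   ([weight_gap]),
where [D x] is a positive combination of the [ln_gap t].  As [ln_gap] vanishes
only at [1], [D x] is nonnegative and vanishes only at [z]: this gives the
optimality of [z] and its uniqueness at once. *)

(** * Scalar inequalities, and argmin as a singleton *)

(** The distance from the graph of [ln] up to its tangent at [1];
[ln_gap (x / y)] is the Itakura-Saito divergence of [x] from [y]. *)
Definition ln_gap (R : realType) (t : R) : R := t - 1 - ln t.

Lemma ln_gap_ge0 (R : realType) (t : R) : 0 < t -> 0 <= ln_gap t.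
Proof.
by move=> t0; have := expR_ge1Dx (ln t); rewrite lnK // /ln_gap; lra.
Qed.

Lemma ln_gap_eq0 (R : realType) (t : R) : 0 < t -> ln_gap t = 0 -> t = 1.
Proof.
move=> t0 gap0; have [|nz] := eqVneq (ln t) 0.
  by move=> /eqP; rewrite ln_eq0 // => /eqP.
by have := expR_gt1Dx nz; rewrite lnK //; move: gap0; rewrite /ln_gap; lra.
Qed.

Lemma expR_tangent (R : realType) (u v : R) :
  expR v * (1 + (u - v)) <= expR u.
Proof.
rewrite -{2}[u](subrK v) [_ - v + v]addrC expRD.
by rewrite ler_pM2l ?expR_gt0 // expR_ge1Dx.
Qed.

Lemma divr1D_lt_mono (R : realType) (u v : R) :
  0 <= u -> 0 <= v -> (u / (1 + u) <= v / (1 + v)) = (u <= v).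
Proof.
move=> u0 v0; rewrite ler_pdivrMr; last lra.
rewrite mulrAC ler_pdivlMr; last lra.
by apply/idP/idP; nra.
Qed.

Lemma argmin_eq1 (R : realType) (T : Type) (X : set T) (f : T -> R) (a : T) :
  X a -> (forall y, X y -> f a <= f y) ->
  (forall y, X y -> f y <= f a -> y = a) -> argmin X f = [set a].
Proof.
move=> Xa fa_min fa_uniq; apply/seteqP; split => [y [Xy fy_min] | _ ->] //=.
by apply: fa_uniq => //; apply: fy_min.
Qed.

Lemma big_fsetU_disjoint (V : nmodType) (T : choiceType) (A B : {fset T})
    (F : T -> V) :
  (A `&` B = fset0)%fset ->
  \sum_(m <- (A `|` B)%fset) F m = \sum_(m <- A) F m + \sum_(m <- B) F m.
Proof.
move=> AB0; rewrite -big_cat /=; apply: perm_big; apply: uniq_perm.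
- exact: fset_uniq.
- rewrite cat_uniq !fset_uniq /= andbT; apply/hasPn => m mB.
  apply/negP => mA; have : m \in (A `&` B)%fset by rewrite inE; apply/andP.
  by rewrite AB0 inE.
- by move=> m; rewrite mem_cat inE.
Qed.

(** * The weight of an allocation *)

Section Allocation.
Variables (R : realType) (N L C : {fset nat}) (alpha beta : nat -> R).
Variable budget : R.

Local Notation feas := (feasible N L C budget).
Local Notation weight := (@pickpocket_weight R N L C alpha beta).
Local Notation opt := (optimal_allocation N L C alpha beta budget).

Definition log_risk (x : allocation R N L C) (i : N) : R :=
  alpha (val i) - \sum_(j : L) beta (val j) * ln (x.1 (i, j))
    - \sum_(j : C) beta (val j) * ln (x.2 j).

Lemma pickpocket_weight_ge0 x : 0 <= weight x.
Proof. by apply: sumr_ge0 => i _; apply: expR_ge0. Qed.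

Lemma BB_weight x : feas x -> BB alpha beta x = weight x.
Proof.
move=> [x1_gt0 x2_gt0 _]; apply: eq_bigr => i _.
have prodE (T : finType) (b f : T -> R) : (forall t, 0 < f t) ->
    \prod_t (f t `^ b t) = expR (\sum_t b t * ln (f t)).
  move=> f_gt0; rewrite expR_sum; apply: eq_bigr => t _.
  by rewrite /powR gt_eqF.
rewrite prodE // (prodE _ _ (fun j => x.1 (i, j))) //.
by rewrite -expRD -expRB opprD addrA addrAC.
Qed.

Lemma PP_le x y : (PP alpha beta x <= PP alpha beta y) = (weight x <= weight y).
Proof. by rewrite divr1D_lt_mono // pickpocket_weight_ge0. Qed.

(** * The candidate optimum *)

Hypothesis N_neq0 : N <> fset0.
Hypothesis disjLC : (L `&` C)%fset = fset0.
Hypothesis CL_neq0 : (C `|` L)%fset <> fset0.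
Hypothesis budget_gt0 : 0 < budget.
Hypothesis beta_gt0 : forall j, j \in (C `|` L)%fset -> 0 < beta j.

Let bL := \sum_(j : L) beta (val j).
Let bC := \sum_(j : C) beta (val j).
Let b := bL + bC.
Let w i := expR (alpha i / (1 + bL)).
Let S := \sum_(i : N) w (val i).

(** The fraction of each local resource that the optimum spends at [i]
(see [opt_localE]). *)
Definition exposure (i : N) : R := w (val i) / S.
(** The central part carries no average over [i] because the exposures sum
to [1]. *)
Definition divergence (x : allocation R N L C) : R :=
  \sum_(i : N) exposure i *
     \sum_(j : L) beta (val j) * ln_gap (x.1 (i, j) / opt.1 (i, j)) +
  \sum_(j : C) beta (val j) * ln_gap (x.2 j / opt.2 j).

Let betaL_gt0 (j : L) : 0 < beta (val j).
Proof. by apply: beta_gt0; rewrite inE (valP j) orbT. Qed.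

Let betaC_gt0 (j : C) : 0 < beta (val j).
Proof. by apply: beta_gt0; rewrite inE (valP j). Qed.

Let bL_ge0 : 0 <= bL. Proof. by apply: sumr_ge0 => j _; apply: ltW. Qed.
Let bC_ge0 : 0 <= bC. Proof. by apply: sumr_ge0 => j _; apply: ltW. Qed.

Let beta_sumE : \sum_(m <- (L `|` C)%fset) beta m = b.
Proof. by rewrite big_fsetU_disjoint // !big_seq_fsetE. Qed.

Let b_gt0 : 0 < b.
Proof.
have sum_gt0 (A : {fset nat}) (j : A) : (forall k : A, 0 < beta (val k)) ->
    0 < \sum_(k : A) beta (val k).
  move=> beta0; rewrite (bigD1 j) //= ltr_pwDl ?(beta0 j) //.
  by apply: sumr_ge0 => k _; apply: ltW (beta0 k).
move/eqP: CL_neq0 => /fset0Pn[j]; rewrite inE => /orP[jC | jL].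
  by rewrite ltr_wpDl // (sum_gt0 _ [` jC]%fset).
by rewrite ltr_pwDl // (sum_gt0 _ [` jL]%fset).
Qed.

Let i0 : N.
Proof. by move/eqP: N_neq0 => /fset0Pn/sigW[i iN]; exact: [` iN]%fset. Qed.

Let S_gt0 : 0 < S.
Proof.
rewrite /S (bigD1 i0) //= ltr_pwDl ?expR_gt0 //.
by apply: sumr_ge0 => i _; apply: expR_ge0.
Qed.

Lemma exposure_gt0 i : 0 < exposure i.
Proof. by rewrite divr_gt0 // expR_gt0. Qed.

Lemma exposure_sum1 : \sum_i exposure i = 1.
Proof. by rewrite -mulr_suml divff // gt_eqF. Qed.

Lemma opt_localE (i : N) (j : L) :
  opt.1 (i, j) = beta (val j) / b * budget * exposure i.
Proof.
by rewrite ffunE beta_sumE !big_seq_fsetE /= -mulrA.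
Qed.

Lemma opt_centralE (j : C) : opt.2 j = beta (val j) / b * budget.
Proof. by rewrite ffunE beta_sumE. Qed.

Let share_gt0 (c : R) : 0 < c -> 0 < c / b * budget.
Proof. by move=> c0; rewrite !mulr_gt0 // invr_gt0. Qed.

Lemma opt_local_gt0 (i : N) (j : L) : 0 < opt.1 (i, j).
rewrite opt_localE mulr_gt0 ?exposure_gt0 //; apply: share_gt0.
exact: betaL_gt0.
Qed.

Lemma opt_central_gt0 (j : C) : 0 < opt.2 j.
Proof. by rewrite opt_centralE; apply: share_gt0; apply: betaC_gt0. Qed.

Lemma opt_feasible : feas opt.
Proof.
split; [exact: opt_local_gt0 | exact: opt_central_gt0 |].
under eq_bigr => i _.
  under eq_bigr => j _ do rewrite opt_localE.
  rewrite -!mulr_suml -/bL mulrC.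
  over.
rewrite -mulr_suml exposure_sum1.
under eq_bigr => j _ do rewrite opt_centralE.
rewrite -!mulr_suml -/bC mul1r -!mulrDl -/b divff ?mul1r //.
by rewrite gt_eqF.
Qed.

(** With [s = 1 + bL], the definition of the exposure reads
[expR (alpha i) = (S * exposure i) ^ s].  The denominator of the [i]-th risk
term contributes [exposure i ^ (- bL)], so that a single power of [exposure i]
is left; the remaining constant is the total weight, since the exposures sum
to [1]. *)
Lemma log_risk_opt i :
  expR (log_risk opt i) = weight opt * exposure i.
Proof.
(* expR k is the factor of expR (log_risk opt i) that does not depend on i. *)
pose k := (1 + bL) * ln S
  - \sum_(j : L) beta (val j) * ln (beta (val j) / b * budget)
  - \sum_(j : C) beta (val j) * ln (opt.2 j).
have riskE i' : expR (log_risk opt i') = expR k * exposure i'.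
  rewrite -[exposure i']lnK ?posrE ?exposure_gt0 // -expRD; congr expR.
  have alphaE : alpha (val i') = (1 + bL) * (ln (exposure i') + ln S).
    rewrite -lnM ?posrE ?exposure_gt0 // /exposure divfK ?gt_eqF //.
    by rewrite expRK mulrC divfK // gt_eqF // ltr_pwDl.
  have localE : \sum_(j : L) beta (val j) * ln (opt.1 (i', j)) =
      \sum_(j : L) beta (val j) * ln (beta (val j) / b * budget)
      + bL * ln (exposure i').
    rewrite mulr_suml -big_split; apply: eq_bigr => j _ /=.
    rewrite opt_localE lnM ?mulrDr // posrE ?exposure_gt0 //.
    exact: share_gt0 (betaL_gt0 j).
  by rewrite /log_risk localE alphaE /k; ring.
have -> : weight opt = expR k.
  rewrite -[RHS]mulr1 -exposure_sum1 mulr_sumr.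
  by apply: eq_bigr => i' _; apply: riskE.
exact: riskE.
Qed.

Lemma weight_opt_gt0 : 0 < weight opt.
Proof.
by rewrite -(pmulr_lgt0 _ (exposure_gt0 i0)) -log_risk_opt expR_gt0.
Qed.

(** * The gap between an allocation and the optimum *)

(** At the optimum, [beta j / opt.2 j] and [exposure i * beta j / opt.1 (i, j)]
all equal [b / budget].  This is why the linear part of the averaged change of
log-risk depends on [x] only through its total spending. *)
Lemma log_risk_avg x : feas x ->
  \sum_i exposure i * (log_risk x i - log_risk opt i) =
  divergence x + b * (1 - (\sum_(i : N) \sum_(j : L) x.1 (i, j)
      + \sum_(j : C) x.2 j) / budget).
Proof.
move=> [x1_gt0 x2_gt0 _].
have diffE i : exposure i * (log_risk x i - log_risk opt i) =
    exposure i *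
      (\sum_(j : L) beta (val j) * ln_gap (x.1 (i, j) / opt.1 (i, j)))
    + exposure i * (b + \sum_(j : C) beta (val j) * ln_gap (x.2 j / opt.2 j)
                    - b / budget * \sum_(j : C) x.2 j)
    - b / budget * \sum_(j : L) x.1 (i, j).
  have e0 := exposure_gt0 i.
  have -> : \sum_(j : L) beta (val j) * ln_gap (x.1 (i, j) / opt.1 (i, j)) =
      b / budget / exposure i * \sum_(j : L) x.1 (i, j) - bL
      - (\sum_(j : L) beta (val j) * ln (x.1 (i, j))
         - \sum_(j : L) beta (val j) * ln (opt.1 (i, j))).
    rewrite mulr_sumr -!sumrB; apply: eq_bigr => j _.
    rewrite /ln_gap ln_div ?posrE ?opt_local_gt0 // {1}opt_localE.
    field.
    by rewrite !gt_eqF.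
  have -> : \sum_(j : C) beta (val j) * ln_gap (x.2 j / opt.2 j) =
      b / budget * \sum_(j : C) x.2 j - bC
      - (\sum_(j : C) beta (val j) * ln (x.2 j)
         - \sum_(j : C) beta (val j) * ln (opt.2 j)).
    rewrite mulr_sumr -!sumrB; apply: eq_bigr => j _.
    rewrite /ln_gap ln_div ?posrE ?opt_central_gt0 // {1}opt_centralE.
    field.
    by rewrite !gt_eqF.
  rewrite /log_risk /b; field.
  by rewrite !gt_eqF.
under eq_bigr do rewrite diffE.
rewrite sumrB big_split /= -mulr_suml exposure_sum1 -mulr_sumr /divergence.
field.
by rewrite gt_eqF.
Qed.

(** The tangent of [expR] at [log_risk opt i] has slope proportional to
[exposure i], so that summing the tangent bounds over [i] produces the average
in [log_risk_avg]; the budget constraint then removes the linear part. *)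
Lemma weight_gap x : feas x ->
  weight opt + weight opt * divergence x <= weight x.
Proof.
move=> xP; have [_ _ x_budget] := xP.
have tangents : weight opt *
    (1 + \sum_i exposure i * (log_risk x i - log_risk opt i)) <= weight x.
  rewrite -{1}exposure_sum1 -big_split mulr_sumr.
  apply: ler_sum => i _ /=; apply: le_trans (expR_tangent _ (log_risk opt i)).
  by rewrite log_risk_opt -/(log_risk x i) -mulrA
    [X in _ <= _ * X]mulrDr mulr1.
apply: le_trans tangents; rewrite log_risk_avg //.
rewrite [leRHS]mulrDr mulr1 lerD2l.
rewrite ler_pM2l ?weight_opt_gt0 // lerDl mulr_ge0 ?(ltW b_gt0) //.
by rewrite subr_ge0 ler_pdivrMr // mul1r.
Qed.

Let local_gap_ge0 x i j : feas x ->
  0 <= beta (val j) * ln_gap (x.1 (i, j) / opt.1 (i, j)).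
Proof.
move=> [x1_gt0 _ _]; rewrite mulr_ge0 ?(ltW (betaL_gt0 j)) //.
by apply: ln_gap_ge0; rewrite divr_gt0 // opt_local_gt0.
Qed.

Let central_gap_ge0 x j : feas x ->
  0 <= beta (val j) * ln_gap (x.2 j / opt.2 j).
Proof.
move=> [_ x2_gt0 _]; rewrite mulr_ge0 ?(ltW (betaC_gt0 j)) //.
by apply: ln_gap_ge0; rewrite divr_gt0 // opt_central_gt0.
Qed.

Let locals_gap_ge0 x i : feas x -> 0 <= exposure i *
  \sum_(j : L) beta (val j) * ln_gap (x.1 (i, j) / opt.1 (i, j)).
Proof.
move=> xP; rewrite mulr_ge0 ?(ltW (exposure_gt0 i)) //.
by apply: sumr_ge0 => j _; apply: local_gap_ge0.
Qed.

Lemma divergence_ge0 x : feas x -> 0 <= divergence x.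
Proof.
move=> xP; apply: addr_ge0; apply: sumr_ge0 => k _.
  exact: locals_gap_ge0.
exact: central_gap_ge0.
Qed.

Lemma divergence_eq0 x : feas x -> divergence x = 0 -> x = opt.
Proof.
move=> xP /eqP; rewrite paddr_eq0; first last.
- by apply: sumr_ge0 => k _; apply: central_gap_ge0.
- by apply: sumr_ge0 => k _; apply: locals_gap_ge0.
have [x1_gt0 x2_gt0 _] := xP.
have ratio1 (u v c : R) : 0 < u -> 0 < v -> 0 < c -> c * ln_gap (u / v) = 0 ->
    u = v.
  move=> u0 v0 c0 /eqP; rewrite mulf_eq0 gt_eqF //= => /eqP /ln_gap_eq0 uv1.
  by apply/divr1_eq/uv1; rewrite divr_gt0.
move=> /andP[/eqP local0 /eqP central0].
rewrite [LHS]surjective_pairing [RHS]surjective_pairing; congr pair.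
  apply/ffunP => -[i j]; apply: ratio1 (betaL_gt0 j) _ => //.
    exact: opt_local_gt0.
  have /(_ i isT) := psumr_eq0P (fun i _ => locals_gap_ge0 i xP) local0.
  move=> /eqP; rewrite mulf_eq0 gt_eqF ?exposure_gt0 //= => /eqP locals0.
  exact: psumr_eq0P (fun j _ => local_gap_ge0 i j xP) locals0 j isT.
apply/ffunP => j; apply: ratio1 (betaC_gt0 j) _ => //.
  exact: opt_central_gt0.
exact: psumr_eq0P (fun j _ => central_gap_ge0 j xP) central0 j isT.
Qed.

Lemma weight_opt_le x : feas x -> weight opt <= weight x.
Proof.
move=> xP; apply: le_trans (weight_gap xP); rewrite lerDl.
by rewrite mulr_ge0 ?divergence_ge0 // (ltW weight_opt_gt0).
Qed.

Lemma weight_opt_uniq x : feas x -> weight x <= weight opt -> x = opt.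
Proof.
move=> xP /(le_trans (weight_gap xP)); rewrite gerDl.
rewrite pmulr_rle0 ?weight_opt_gt0 //.
move=> div_le0; apply: divergence_eq0 => //.
by apply/eqP; rewrite eq_le div_le0 divergence_ge0.
Qed.

End Allocation.

Theorem theorem2 (R : realType) (N L C : {fset nat})
    (alpha beta : nat -> R) (budget : R)
    (N_neq0 : N <> fset0)
    (disjN : (N `&` (C `|` L))%fset = fset0)
    (disjLC : (L `&` C)%fset = fset0)
    (CL_neq0 : (C `|` L)%fset <> fset0)
    (budget_gt0 : 0 < budget)
    (alpha_ge0 : forall i, i \in N -> 0 <= alpha i)
    (beta_gt0 : forall j, j \in (C `|` L)%fset -> 0 < beta j) :
  argmin (feasible N L C budget) (BB alpha beta)
    = [set optimal_allocation N L C alpha beta budget] /\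
  argmin (feasible N L C budget) (PP alpha beta)
    = [set optimal_allocation N L C alpha beta budget].
Proof.
have optP : feasible N L C budget (optimal_allocation N L C alpha beta budget).
  exact: opt_feasible.
split; apply: argmin_eq1 => // y yP;
  rewrite ?PP_le ?(BB_weight _ _ optP) ?(BB_weight _ _ yP).
- exact: weight_opt_le.
- exact: weight_opt_uniq.
- exact: weight_opt_le.
- exact: weight_opt_uniq.
Qed.
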